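(* Let $\mathbb{C}$ be a finitely complete $\mathsf{Ord}$-enriched category which admits comma objects. The following statements are equivalent: (i) The vertical comma object functor $V_{\alpha}\colon \mathsf{Pt}_Y(\mathbb{C})\to \mathsf{Pt}_A(\mathbb{C})$ is conservative for every morphism $\alpha\colon A\to Y$ of $\mathbb{C}$. (ii) For every morphism $\alpha\colon A\to Y$ and every point $(f\colon X\to Y,\ s\colon Y\to X)$ over $Y$ (so $fs=1_Y$), with $(\alpha/f,\pi_1\colon\alpha/f\to A,\pi_2\colon\alpha/f\to X)$ the comma object of $(\alpha,f)$ (regarded as a point over $A$ via $\pi_1$ and its section $i_1=\langle 1_A,s\alpha\rangle$), the pair $(\pi_2\colon\alpha/f\to X,\ s\colon Y\to X)$ is jointly extremally epimorphic.
   Context: $\mathsf{Ord}$ is the category of preordered sets (reflexive, transitive relations) and monotone maps. An $\mathsf{Ord}$-enriched category $\mathbb{C}$ is a category whose hom-sets $\mathbb{C}(X,Y)$ carry a preorder $\preccurlyeq$ preserved by pre- and postcomposition. ''Finitely complete'' means that it has finite limits. Comma object of an ordered pair $(f\colon X\to Y,\ g\colon Z\to Y)$: an object $f/g$ with morphisms $\pi_1\colon f/g\to X$, $\pi_2\colon f/g\to Z$ such that (C1) $f\pi_1\preccurlyeq g\pi_2$; (C2) for all $a\colon A\to X$, $b\colon A\to Z$ with $fa\preccurlyeq gb$ there is a unique $\lambda=\langle a,b\rangle\colon A\to f/g$ with $\pi_1\lambda=a$, $\pi_2\lambda=b$; (C3) if $fa\preccurlyeq gb$, $fa'\preccurlyeq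 gb'$, $a\preccurlyeq a'$ and $b\preccurlyeq b'$, then $\langle a,b\rangle\preccurlyeq\langle a',b'\rangle$. ''$\mathbb{C}$ admits comma objects'' means that every such pair has one. A point over $Y$ is a pair $(f\colon X\to Y,\ s\colon Y\to X)$ with $fs=1_Y$. $\mathsf{Pt}_Y(\mathbb{C})$ is the category of points over $Y$; a morphism $\gamma\colon(g\colon Z\to Y,t)\to(f\colon X\to Y,s)$ is a morphism $\gamma\colon Z\to X$ with $f\gamma=g$ and $\gamma t=s$. For $\alpha\colon A\to Y$, the vertical comma object change-of-base functor $V_\alpha\colon\mathsf{Pt}_Y(\mathbb{C})\to\mathsf{Pt}_A(\mathbb{C})$ sends $(f,s)$ to the point $(\pi_1\colon\alpha/f\to A,\ \langle 1_A,s\alpha\rangle\colon A\to\alpha/f)$, where $(\alpha/f,\pi_1,\pi_2)$ is the comma object of $(\alpha,f)$, and sends $\gamma\colon(g,t)\to(f,s)$ to the morphism $\alpha/g\to\alpha/f$ induced by the universal property, namely $\langle\rho_1,\gamma\rho_2\rangle$ with $\rho_1,\rho_2$ the projections of $\alpha/g$. A functor is conservative if it reflects isomorphisms. A pair of morphisms with common codomain $X$ is jointly extremally epimorphic if every monomorphism $m\colon M\to X$ through which both of them factor is an isomorphism. *)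

(* Defs.v *)
(* Vanilla Stdlib.  Equality of morphisms is Leibniz equality; proof irrelevance
   is used so that a morphism of points is determined by its underlying
   morphism. *)
From Stdlib Require Import RelationClasses List ProofIrrelevance.

Set Implicit Arguments.
Unset Strict Implicit.

Declare Scope cat_scope.
Open Scope cat_scope.

Record category := Category {
  obj :> Type;
  hom : obj -> obj -> Type;
  id : forall X, hom X X;
  comp : forall X Y Z, hom Y Z -> hom X Y -> hom X Z;
  comp_id_l : forall X Y (f : hom X Y), comp (id Y) f = f;
  comp_id_r : forall X Y (f : hom X Y), comp f (id X) = f;
  comp_assoc : forall W X Y Z (h : hom Y Z) (g : hom X Y) (f : hom W X),
    comp h (comp g f) = comp (comp h g) f
}.

Arguments hom {c} _ _.
Arguments id {c} _.
Arguments comp {c X Y Z} _ _.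

Notation "g ∘ f" := (comp g f) (at level 40, left associativity) : cat_scope.

Definition is_iso (C : category) (X Y : C) (f : hom X Y) : Prop :=
  exists g : hom Y X, g ∘ f = id X /\ f ∘ g = id Y.

Definition is_mono (C : category) (X Y : C) (f : hom X Y) : Prop :=
  forall (A : C) (a b : hom A X), f ∘ a = f ∘ b -> a = b.

Definition jointly_extremally_epic (C : category) (A B X : C)
    (f : hom A X) (g : hom B X) : Prop :=
  forall (M : C) (m : hom M X), is_mono m ->
    (exists u : hom A M, m ∘ u = f) ->
    (exists v : hom B M, m ∘ v = g) ->
    is_iso m.

Record functor (C D : category) := Functor {
  fobj :> C -> D;
  fmap : forall X Y : C, hom X Y -> hom (fobj X) (fobj Y);
  fmap_id : forall X : C, fmap (id X) = id (fobj X);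
  fmap_comp : forall (X Y Z : C) (g : hom Y Z) (f : hom X Y),
    fmap (g ∘ f) = fmap g ∘ fmap f
}.

Arguments fmap {C D} _ {X Y} _.

Definition conservative (C D : category) (F : functor C D) : Prop :=
  forall (X Y : C) (f : hom X Y), is_iso (fmap F f) -> is_iso f.

Record cone (J C : category) (D : functor J C) := Cone {
  apex : C;
  leg : forall j : J, hom apex (D j);
  leg_natural : forall (i j : J) (u : hom i j), fmap D u ∘ leg i = leg j
}.

Arguments leg {J C D} _ _.

Definition is_limit (J C : category) (D : functor J C) (L : cone D) : Prop :=
  forall K : cone D, exists! h : hom (apex K) (apex L),
    forall j : J, leg L j ∘ h = leg K j.

Definition finite (T : Type) : Prop := exists s : list T, forall x, In x s.

Definition finite_category (J : category) : Prop :=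
  finite J /\ forall i j : J, finite (hom i j).

Definition finitely_complete (C : category) : Prop :=
  forall (J : category), finite_category J ->
  forall D : functor J C, exists L : cone D, is_limit L.

Record ord_category := OrdCategory {
  ord_cat :> category;
  hle : forall X Y : ord_cat, hom X Y -> hom X Y -> Prop;
  hle_preorder : forall X Y : ord_cat, PreOrder (@hle X Y);
  hle_comp_l : forall (X Y Z : ord_cat) (h : hom Y Z) (f g : hom X Y),
    hle f g -> hle (h ∘ f) (h ∘ g);
  hle_comp_r : forall (X Y Z : ord_cat) (f g : hom Y Z) (h : hom X Y),
    hle f g -> hle (f ∘ h) (g ∘ h)
}.

Notation "f ≼ g" := (hle f g) (at level 70, no associativity) : cat_scope.

(* The morphism <a, b> is carried as data; it is determined by [comma_pair_unique],
   so it does not depend on the proof of f ∘ a ≼ g ∘ b. *)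
Record comma_object (C : ord_category) (X Y Z : C)
    (f : hom X Y) (g : hom Z Y) := CommaObject {
  comma :> C;
  pi1 : hom comma X;
  pi2 : hom comma Z;
  comma_le : f ∘ pi1 ≼ g ∘ pi2;
  comma_pair : forall (A : C) (a : hom A X) (b : hom A Z),
    f ∘ a ≼ g ∘ b -> hom A comma;
  pi1_comma_pair : forall (A : C) (a : hom A X) (b : hom A Z) (l : f ∘ a ≼ g ∘ b),
    pi1 ∘ comma_pair l = a;
  pi2_comma_pair : forall (A : C) (a : hom A X) (b : hom A Z) (l : f ∘ a ≼ g ∘ b),
    pi2 ∘ comma_pair l = b;
  comma_pair_unique : forall (A : C) (a : hom A X) (b : hom A Z)
      (l : f ∘ a ≼ g ∘ b) (h : hom A comma),
    pi1 ∘ h = a -> pi2 ∘ h = b -> h = comma_pair l;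
  comma_pair_le : forall (A : C) (a a' : hom A X) (b b' : hom A Z)
      (l : f ∘ a ≼ g ∘ b) (l' : f ∘ a' ≼ g ∘ b'),
    a ≼ a' -> b ≼ b' -> comma_pair l ≼ comma_pair l'
}.

Arguments pi1 {C X Y Z f g} _.
Arguments pi2 {C X Y Z f g} _.
Arguments comma_pair {C X Y Z f g} _ {A a b} _.

(* A choice of comma objects, needed for the change-of-base functors to be
   defined on objects. *)
Definition comma_choice (C : ord_category) : Type :=
  forall (X Y Z : C) (f : hom X Y) (g : hom Z Y), comma_object f g.

Record point (C : category) (Y : C) := Point {
  pt_obj : C;
  pt_map : hom pt_obj Y;
  pt_sec : hom Y pt_obj;
  pt_split : pt_map ∘ pt_sec = id Y
}.

Arguments Point {C Y pt_obj pt_map pt_sec} pt_split.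

Record point_hom (C : category) (Y : C) (p q : point Y) := PointHom {
  pt_hom :> hom (pt_obj p) (pt_obj q);
  pt_hom_map : pt_map q ∘ pt_hom = pt_map p;
  pt_hom_sec : pt_hom ∘ pt_sec p = pt_sec q
}.

Arguments PointHom {C Y p q pt_hom} pt_hom_map pt_hom_sec.

Lemma point_hom_eq (C : category) (Y : C) (p q : point Y) (u v : point_hom p q) :
  pt_hom u = pt_hom v -> u = v.
Proof.
destruct u as [u u1 u2], v as [v v1 v2]; simpl; intros e; destruct e.
f_equal; apply proof_irrelevance.
Qed.

Section PointCategory.

Variables (C : category) (Y : C).

Lemma point_id_map (p : point Y) : pt_map p ∘ id (pt_obj p) = pt_map p.
Proof. apply comp_id_r. Qed.

Lemma point_id_sec (p : point Y) : id (pt_obj p) ∘ pt_sec p = pt_sec p.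
Proof. apply comp_id_l. Qed.

Definition point_id (p : point Y) : point_hom p p :=
  PointHom (point_id_map p) (point_id_sec p).

Lemma point_comp_map (p q r : point Y) (v : point_hom q r) (u : point_hom p q) :
  pt_map r ∘ (v ∘ u) = pt_map p.
Proof. rewrite comp_assoc, (pt_hom_map v); apply pt_hom_map. Qed.

Lemma point_comp_sec (p q r : point Y) (v : point_hom q r) (u : point_hom p q) :
  (v ∘ u) ∘ pt_sec p = pt_sec r.
Proof. rewrite <- comp_assoc, (pt_hom_sec u); apply pt_hom_sec. Qed.

Definition point_comp (p q r : point Y) (v : point_hom q r) (u : point_hom p q) :
    point_hom p r :=
  PointHom (point_comp_map v u) (point_comp_sec v u).

Lemma point_comp_id_l (p q : point Y) (u : point_hom p q) :
  point_comp (point_id q) u = u.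
Proof. apply point_hom_eq, comp_id_l. Qed.

Lemma point_comp_id_r (p q : point Y) (u : point_hom p q) :
  point_comp u (point_id p) = u.
Proof. apply point_hom_eq, comp_id_r. Qed.

Lemma point_comp_assoc (p q r s : point Y)
    (w : point_hom r s) (v : point_hom q r) (u : point_hom p q) :
  point_comp w (point_comp v u) = point_comp (point_comp w v) u.
Proof. apply point_hom_eq, comp_assoc. Qed.

Definition Pt : category :=
  Category point_comp_id_l point_comp_id_r point_comp_assoc.

End PointCategory.

Section VerticalCommaFunctor.

Variables (C : ord_category) (K : comma_choice C) (A Y : C) (α : hom A Y).

Lemma vertical_sec_le (p : point Y) : α ∘ id A ≼ pt_map p ∘ (pt_sec p ∘ α).
Proof.
rewrite comp_assoc, (pt_split p), comp_id_l, comp_id_r.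
apply (hle_preorder A Y).
Qed.

Definition vertical_obj (p : point Y) : point A :=
  Point (pi1_comma_pair (K α (pt_map p)) (vertical_sec_le p)).

Lemma vertical_hom_le (p q : point Y) (γ : point_hom p q) :
  α ∘ pi1 (K α (pt_map p)) ≼ pt_map q ∘ (γ ∘ pi2 (K α (pt_map p))).
Proof. rewrite comp_assoc, (pt_hom_map γ); apply comma_le. Qed.

Definition vertical_map (p q : point Y) (γ : point_hom p q) :
    hom (K α (pt_map p)) (K α (pt_map q)) :=
  comma_pair (K α (pt_map q)) (vertical_hom_le γ).

Lemma vertical_map_map (p q : point Y) (γ : point_hom p q) :
  pt_map (vertical_obj q) ∘ vertical_map γ = pt_map (vertical_obj p).
Proof. apply pi1_comma_pair. Qed.

Lemma vertical_map_sec (p q : point Y) (γ : point_hom p q) :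
  vertical_map γ ∘ pt_sec (vertical_obj p) = pt_sec (vertical_obj q).
Proof.
apply comma_pair_unique; unfold vertical_map; simpl; rewrite comp_assoc.
- now rewrite pi1_comma_pair, pi1_comma_pair.
- now rewrite pi2_comma_pair, <- comp_assoc, pi2_comma_pair, comp_assoc, (pt_hom_sec γ).
Qed.

Definition vertical_hom (p q : point Y) (γ : point_hom p q) :
    point_hom (vertical_obj p) (vertical_obj q) :=
  @PointHom C A (vertical_obj p) (vertical_obj q) (vertical_map γ)
    (vertical_map_map γ) (vertical_map_sec γ).

Lemma vertical_hom_id (p : Pt Y) :
  vertical_hom (id p) = @id (Pt A) (vertical_obj p).
Proof.
apply point_hom_eq; symmetry; apply comma_pair_unique; simpl.
- apply comp_id_r.
- now rewrite comp_id_l, comp_id_r.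
Qed.

Lemma vertical_hom_comp (p q r : Pt Y) (δ : hom q r) (γ : hom p q) :
  vertical_hom (δ ∘ γ) = point_comp (vertical_hom δ) (vertical_hom γ).
Proof.
apply point_hom_eq; symmetry; apply comma_pair_unique; simpl;
  unfold vertical_map; rewrite comp_assoc.
- now rewrite pi1_comma_pair, pi1_comma_pair.
- now rewrite pi2_comma_pair, <- comp_assoc, pi2_comma_pair, comp_assoc.
Qed.

Definition vertical_functor : functor (Pt Y) (Pt A) :=
  @Functor (Pt Y) (Pt A) vertical_obj vertical_hom
    vertical_hom_id vertical_hom_comp.

End VerticalCommaFunctor.

(* Main.v *)
Require Import Defs.
From Stdlib Require Import List.

(** Write (ρ1, ρ2) for the projections of α/g and (π1, π2) for those of α/f.

    From conservativity to extremal epimorphy: let a mono m : M → X factor both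
    π2 = m u and s = m v. Then m is a morphism of points (f m, v) → (f, s), and
    <π1, u> is inverse to V_α(m), because u supplies the missing second
    projection and m is mono. Hence m is an isomorphism
    ([vertical_map_iso_of_mono]).

    Conversely, let γ : (g, t) → (f, s) with V_α(γ) invertible. Both π2 and
    s = γ t factor through γ, so the pair (π2, s) being jointly extremally epic
    makes γ invertible as soon as γ is mono. That γ is mono is the content of
    [mono_of_vertical_map_mono], which applies the hypothesis a second time,
    to a point carried by the kernel pair of γ: injectivity of V_α(γ) says that
    γ is left cancellable on the morphisms that factor through ρ2, which forces the
    two kernel projections to agree on the comma object over the kernel pair;
    the diagonal, a split mono, therefore absorbs the extremally epic pair and
    is an isomorphism. *)

(** * Pullbacks as finite limits *)

Section Cospan.

Inductive cospan_obj := Left | Right | Tip.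

Definition cospan_hom (i j : cospan_obj) : Type :=
  match i, j with
  | Left, Left | Right, Right | Tip, Tip | Left, Tip | Right, Tip => unit
  | _, _ => Empty_set
  end.

Definition cospan_id (i : cospan_obj) : cospan_hom i i :=
  match i with Left | Right | Tip => tt end.

Definition cospan_comp (i j k : cospan_obj) :
  cospan_hom j k -> cospan_hom i j -> cospan_hom i k.
Proof. destruct i, j, k; simpl; intros v u; easy || exact tt. Defined.

Lemma cospan_hom_unique (i j : cospan_obj) (u v : cospan_hom i j) : u = v.
Proof. now destruct i, j, u, v. Qed.

Definition cospan : category :=
  @Category cospan_obj cospan_hom cospan_id cospan_comp
    (fun _ _ _ => cospan_hom_unique _ _ _ _)
    (fun _ _ _ => cospan_hom_unique _ _ _ _)
    (fun _ _ _ _ _ _ _ => cospan_hom_unique _ _ _ _).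

Lemma cospan_finite : finite_category cospan.
Proof.
split.
- exists (Left :: Right :: Tip :: nil); intros []; simpl; tauto.
- intros i j; destruct i, j; simpl;
    (exists (tt :: nil); intros []; simpl; tauto) || (exists nil; intros []).
Qed.

Variables (C : category) (X Y Z : C) (f : hom X Z) (g : hom Y Z).

Definition cospan_diagram_obj (i : cospan) : C :=
  match i with Left => X | Right => Y | Tip => Z end.

Definition cospan_diagram_map (i j : cospan) :
  hom i j -> hom (cospan_diagram_obj i) (cospan_diagram_obj j) :=
  match i, j with
  | Left, Left => fun _ => id X
  | Right, Right => fun _ => id Y
  | Tip, Tip => fun _ => id Z
  | Left, Tip => fun _ => f
  | Right, Tip => fun _ => g
  | _, _ => fun u : Empty_set => match u with end
  end.

Lemma cospan_diagram_id (i : cospan) :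
  cospan_diagram_map i i (id i) = id (cospan_diagram_obj i).
Proof. now destruct i. Qed.

Lemma cospan_diagram_comp (i j k : cospan) (v : hom j k) (u : hom i j) :
  cospan_diagram_map i k (v ∘ u)
  = cospan_diagram_map j k v ∘ cospan_diagram_map i j u.
Proof.
destruct i, j, k; destruct u, v; simpl;
  now rewrite ?comp_id_l, ?comp_id_r.
Qed.

Definition cospan_diagram : functor cospan C :=
  Functor cospan_diagram_id cospan_diagram_comp.

Definition cospan_cone_leg (W : C) (a : hom W X) (b : hom W Y) (i : cospan) :
  hom W (cospan_diagram i) :=
  match i with Left => a | Right => b | Tip => f ∘ a end.

Lemma cospan_cone_natural (W : C) (a : hom W X) (b : hom W Y) :
  f ∘ a = g ∘ b -> forall (i j : cospan) (u : hom i j),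
  fmap cospan_diagram u ∘ cospan_cone_leg W a b i = cospan_cone_leg W a b j.
Proof.
intros e i j u; destruct i, j; destruct u; simpl; now rewrite ?comp_id_l.
Qed.

(** The projections are jointly monic by the uniqueness half of the universal
    property; separating it from existence spares every later use an [exists!]. *)
Lemma pullback_exists : finitely_complete C ->
  exists (P : C) (p : hom P X) (q : hom P Y),
    f ∘ p = g ∘ q /\
    (forall (W : C) (a : hom W X) (b : hom W Y), f ∘ a = g ∘ b ->
       exists h : hom W P, p ∘ h = a /\ q ∘ h = b) /\
    (forall (W : C) (h k : hom W P), p ∘ h = p ∘ k -> q ∘ h = q ∘ k -> h = k).
Proof.
intros HC; destruct (HC cospan cospan_finite cospan_diagram) as [L HL].
pose (p := leg L Left : hom (apex L) X); pose (q := leg L Right : hom (apex L) Y).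
assert (ep : f ∘ p = leg L Tip) by apply (leg_natural L (i := Left) (j := Tip) tt).
assert (eq : g ∘ q = leg L Tip) by apply (leg_natural L (i := Right) (j := Tip) tt).
exists (apex L), p, q; split; [congruence | split].
- intros W a b e.
  destruct (HL (Cone (cospan_cone_natural W a b e))) as [h [Hh _]].
  exists h; split; [apply (Hh Left) | apply (Hh Right)].
- intros W h k e1 e2.
  assert (e : f ∘ (p ∘ k) = g ∘ (q ∘ k)) by (rewrite !comp_assoc; congruence).
  destruct (HL (Cone (cospan_cone_natural W _ _ e))) as [w [_ Hw]].
  transitivity w; [symmetry |]; apply Hw; intros []; simpl; trivial.
  + rewrite <- ep, <- comp_assoc; now f_equal.
  + now rewrite <- ep, <- comp_assoc.
Qed.

End Cospan.

(** * Isomorphisms of points *)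

Lemma point_iso_iff (C : category) (Y : C) (p q : Pt Y) (γ : hom p q) :
  is_iso γ <-> is_iso (pt_hom γ).
Proof.
split.
- intros [δ [e1 e2]]; exists (pt_hom δ); split.
  + exact (f_equal (@pt_hom _ _ _ _) e1).
  + exact (f_equal (@pt_hom _ _ _ _) e2).
- intros [d [e1 e2]].
  assert (Hmap : pt_map p ∘ d = pt_map q).
  { rewrite <- (pt_hom_map γ), <- comp_assoc, e2; apply comp_id_r. }
  assert (Hsec : d ∘ pt_sec q = pt_sec p).
  { rewrite <- (pt_hom_sec γ), comp_assoc, e1; apply comp_id_l. }
  exists (PointHom Hmap Hsec); split; apply point_hom_eq; assumption.
Qed.

Lemma iso_mono (C : category) (X Y : C) (f : hom X Y) : is_iso f -> is_mono f.
Proof.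
intros [g [e _]] A a b E.
rewrite <- (comp_id_l a), <- (comp_id_l b), <- e, <- !comp_assoc; congruence.
Qed.

Lemma split_mono (C : category) (X Y : C) (d : hom X Y) (r : hom Y X) :
  r ∘ d = id X -> is_mono d.
Proof.
intros e A a b E.
rewrite <- (comp_id_l a), <- (comp_id_l b), <- e, <- !comp_assoc; congruence.
Qed.

(** * The vertical comma functor *)

Lemma comma_jointly_monic (C : ord_category) (X Y Z : C)
    (f : hom X Y) (g : hom Z Y) (P : comma_object f g)
    (A : C) (h k : hom A P) :
  pi1 P ∘ h = pi1 P ∘ k -> pi2 P ∘ h = pi2 P ∘ k -> h = k.
Proof.
intros e1 e2.
assert (l : f ∘ (pi1 P ∘ k) ≼ g ∘ (pi2 P ∘ k)).
{ rewrite !comp_assoc; apply hle_comp_r, comma_le. }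
transitivity (comma_pair P l).
- now apply comma_pair_unique.
- symmetry; now apply comma_pair_unique.
Qed.

Section VerticalFunctor.

Variables (C : ord_category) (K : comma_choice C) (A Y : C) (α : hom A Y).
Variables (p q : point Y) (γ : point_hom p q).

Local Notation P := (K A Y _ α (pt_map p)).
Local Notation Q := (K A Y _ α (pt_map q)).

Lemma pi1_vertical_map : pi1 Q ∘ vertical_map K α γ = pi1 P.
Proof. apply pi1_comma_pair. Qed.

Lemma pi2_vertical_map : pi2 Q ∘ vertical_map K α γ = γ ∘ pi2 P.
Proof. apply pi2_comma_pair. Qed.

(** The comma object only sees those generalized elements of [pt_obj q] whose
    image in Y lies above one of the form [α ∘ a]; if the generic one, [pi2 Q],
    already lifts along the mono γ, passing from q to p loses none of them. *)
Lemma vertical_map_iso_of_mono (u : hom Q (pt_obj p)) :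
  is_mono (pt_hom γ) -> γ ∘ u = pi2 Q -> is_iso (vertical_map K α γ).
Proof.
intros Hm Hu.
assert (l : α ∘ pi1 Q ≼ pt_map p ∘ u).
{ rewrite <- (pt_hom_map γ), <- comp_assoc, Hu; apply comma_le. }
exists (comma_pair P l); split; apply comma_jointly_monic.
- rewrite comp_assoc, pi1_comma_pair, comp_id_r; apply pi1_vertical_map.
- rewrite comp_assoc, pi2_comma_pair, comp_id_r; apply Hm.
  rewrite comp_assoc, Hu; apply pi2_vertical_map.
- rewrite comp_assoc; rewrite pi1_vertical_map, comp_id_r.
  apply pi1_comma_pair.
- rewrite comp_assoc; rewrite pi2_vertical_map, comp_id_r.
  now rewrite <- comp_assoc, pi2_comma_pair.
Qed.

(** A morphism into [pt_obj p] whose composite with [pt_map p] is bounded below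
    by some [α ∘ a] is the second component of a morphism into P, so γ can be
    cancelled on it. *)
Lemma vertical_map_mono_cancel (W : C) (a : hom W A) (b b' : hom W (pt_obj p)) :
  is_mono (vertical_map K α γ) ->
  α ∘ a ≼ pt_map p ∘ b -> γ ∘ b = γ ∘ b' -> b = b'.
Proof.
intros Hm l e.
assert (l' : α ∘ a ≼ pt_map p ∘ b').
{ rewrite <- (pt_hom_map γ), <- comp_assoc, <- e, comp_assoc, (pt_hom_map γ).
  exact l. }
rewrite <- (pi2_comma_pair P l), <- (pi2_comma_pair P l'); f_equal.
apply Hm, comma_jointly_monic; rewrite !comp_assoc.
- now rewrite pi1_vertical_map, !pi1_comma_pair.
- now rewrite pi2_vertical_map, <- !comp_assoc, !pi2_comma_pair.
Qed.

(** The kernel pair (E, k1, k2) of γ carries the point (g k1, <t, t>) over Y,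
    and it is to this point that the extremal epimorphy is applied: on its comma
    object k1 and k2 agree, so the diagonal Z → E is invertible, that is,
    k1 = k2. *)
Lemma mono_of_vertical_map_mono :
  finitely_complete C ->
  (forall (X : C) (f : hom X Y) (s : hom Y X), f ∘ s = id Y ->
     jointly_extremally_epic (pi2 (K A Y X α f)) s) ->
  is_mono (vertical_map K α γ) -> is_mono (pt_hom γ).
Proof.
intros HC Hepi Hm.
destruct (pullback_exists _ _ _ _ (pt_hom γ) (pt_hom γ) HC)
  as (E & k1 & k2 & Hk & Hlift & Hjm).
destruct (Hlift _ (id _) (id _) eq_refl) as (d & Hd1 & Hd2).
assert (Hsplit : (pt_map p ∘ k1) ∘ (d ∘ pt_sec p) = id Y).
{ rewrite <- comp_assoc, (comp_assoc k1), Hd1, comp_id_l; apply pt_split. }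
assert (Hd : is_iso d).
{ apply (Hepi _ _ _ Hsplit); [now apply split_mono with k1 | | now exists (pt_sec p)].
  set (R := K A Y E α (pt_map p ∘ k1)).
  assert (Hagree : k1 ∘ pi2 R = k2 ∘ pi2 R).
  { apply (vertical_map_mono_cancel _ (pi1 R)); trivial.
    - rewrite comp_assoc; apply comma_le.
    - rewrite !comp_assoc; now f_equal. }
  exists (k1 ∘ pi2 R); apply Hjm; rewrite comp_assoc.
  - now rewrite Hd1, comp_id_l.
  - now rewrite Hd2, comp_id_l. }
assert (Hk12 : k1 = k2).
{ destruct Hd as (e & _ & He).
  rewrite <- (comp_id_r k1), <- (comp_id_r k2), <- He, !comp_assoc; congruence. }
intros W a b Hab; destruct (Hlift _ a b Hab) as (h & <- & <-); now rewrite Hk12.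
Qed.

End VerticalFunctor.

Theorem theorem2p11 (C : ord_category) (HC : finitely_complete C)
    (K : comma_choice C) :
  (forall (A Y : C) (α : hom A Y), conservative (vertical_functor K α))
  <->
  (forall (A Y : C) (α : hom A Y) (X : C) (f : hom X Y) (s : hom Y X),
     f ∘ s = id Y ->
     jointly_extremally_epic (pi2 (K A Y X α f)) s).
Proof.
split.
- intros Hcons A Y α X f s Hfs M m Hm [u Hu] [v Hv].
  assert (Hsplit : (f ∘ m) ∘ v = id Y) by now rewrite <- comp_assoc, Hv.
  pose (γ := @PointHom C Y (Point Hsplit) (Point Hfs) m eq_refl Hv).
  apply (point_iso_iff C Y (Point Hsplit) (Point Hfs) γ).
  apply (Hcons A Y α), point_iso_iff.
  exact (vertical_map_iso_of_mono C K A Y α _ _ γ u Hm Hu).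
- intros Hepi A Y α p q γ Hiso.
  apply point_iso_iff in Hiso; apply point_iso_iff.
  change (is_iso (vertical_map K α γ)) in Hiso.
  apply (Hepi A Y α _ (pt_map q) (pt_sec q) (pt_split q)).
  + apply (mono_of_vertical_map_mono C K A Y α p q γ HC (Hepi A Y α)).
    now apply iso_mono.
  + destruct Hiso as (w & _ & Hw).
    exists (pi2 (K A Y _ α (pt_map p)) ∘ w).
    rewrite comp_assoc, <- pi2_vertical_map, <- comp_assoc, Hw.
    apply comp_id_r.
  + exists (pt_sec p); apply pt_hom_sec.
Qed.
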